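(* Let $A\subset\mathbb{R}$ be a nonempty finite set and let $f:I\to\mathbb{R}$ be a strictly convex or strictly concave function on an interval $I\subset\mathbb{R}$ containing $A+A$. Then there exist $a,a'\in A$ such that \[ |f(a+A)+f(a'+A)-f(a+A)| \gg |A|^2 . \]
   Context: For $a \in \mathbb{R}$, $f(a+A)=\{f(a+x):x\in A\}$. For sets $S,T,U \subset \mathbb{R}$, $S+T-U=\{s+t-u: s\in S,t\in T,u\in U\}$. $|\cdot|$ is cardinality. $X\gg Y$ means $X\ge cY$ for some absolute constant $c>0$ (independent of $A$ and $f$). *)

(* Defs.v *)
From mathcomp Require Import all_boot all_order all_algebra finmap.
From mathcomp Require Import reals.

Set Implicit Arguments.
Unset Strict Implicit.
Unset Printing Implicit Defensive.

Import Order.TTheory GRing.Theory Num.Theory.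
Local Open Scope fset_scope.
Local Open Scope ring_scope.

Definition sumset (R : realType) (S T : {fset R}) : {fset R} :=
  [fset s + t | s in S, t in T].

Definition diffset (R : realType) (S T : {fset R}) : {fset R} :=
  [fset s - t | s in S, t in T].

(* f(a + A) *)
Definition shift_image (R : realType) (f : R -> R) (a : R) (A : {fset R}) :
    {fset R} :=
  [fset f (a + x) | x in A].

(* A function I -> R is represented by a total function of which only the
   values on I are constrained. *)
Definition strictly_convex_on (R : realType) (I : interval R) (f : R -> R) :
    Prop :=
  forall x y t : R, x \in I -> y \in I -> x != y -> 0 < t -> t < 1 ->
    f (t * x + (1 - t) * y) < t * f x + (1 - t) * f y.

Definition strictly_concave_on (R : realType) (I : interval R) (f : R -> R) :
    Prop :=
  forall x y t : R, x \in I -> y \in I -> x != y -> 0 < t -> t < 1 ->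
    t * f x + (1 - t) * f y < f (t * x + (1 - t) * y).

(* Main.v *)
Require Import Defs.
From mathcomp Require Import all_boot all_order all_algebra finmap.
From mathcomp Require Import reals.
From mathcomp Require Import ring lra zify.

(** For convex [f], let [d = a' - a] be the least positive difference in [A], and put
    [D z = f (a' + z) - f (a + z)], which is strictly increasing by convexity.
    Where [f] increases, consecutive points of [f (a + A)] are "[d]-spread", so that
    the numbers [f (a + x) + D z] with [z <= x] stay between [f (a + x)] and
    the next element of [f (a + A)], and are pairwise distinct.  Where [f] decreases
    the same holds with [a] and [a'] exchanged, and one of the two ranges contains
    about half of [A]. *)

Set Implicit Arguments.
Unset Strict Implicit.
Unset Printing Implicit Defensive.

Import Order.TTheory GRing.Theory Num.Theory.
Local Open Scope fset_scope.
Local Open Scope ring_scope.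

Lemma card_fsetM (K K' : choiceType) (A : {fset K}) (B : {fset K'}) :
  #|` A `*` B| = (#|` A| * #|` B|)%N.
Proof.
rewrite -(size_allpairs pair); apply/perm_size/uniq_perm; rewrite ?fset_uniq //.
  by apply: allpairs_uniq; rewrite ?fset_uniq // => -[x y] [x' y'] _ _ /= [-> ->].
move=> [x y]; rewrite in_fsetM /=; apply/andP/allpairsP => [[xA yB]|].
  by exists (x, y).
by move=> [[x' y'] /= [xA yB [-> ->]]].
Qed.

Lemma leq_card_in_inj (K K' : choiceType) (f : K -> K') (A : {fset K}) (B : {fset K'}) :
  {in A &, injective f} -> {in A, forall x, f x \in B} -> (#|` A| <= #|` B|)%N.
Proof.
move=> injf fAB.
have <- : #|` [fset f x | x in A]| = #|` A| by exact: card_in_imfset.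
by apply/fsubset_leq_card/fsubsetP => _ /imfsetP[x xA ->]; apply: fAB.
Qed.

(* Ordering [P] by [D] rather than by [<=] serves the increasing and the
   decreasing range of a convex function at once. *)
Lemma card_squeezed (R : realDomainType) (P S : {fset R}) (g D : R -> R) :
  {in P &, injective D} ->
  {in P, forall x, 0 < D x} ->
  {in P &, forall x y, D x < D y -> g x + D x <= g y} ->
  {in P &, forall x z, g x + D z \in S} ->
  (#|` P| ^ 2 <= 2 * #|` S|)%N.
Proof.
move=> injD D_gt0 gD_le inS.
(* For [(x, z)] in [T], the value [g x + D z] lies in the half-open interval from [g x] (excluded)
   to [g x + D x] (included). These intervals are disjoint for distinct [x], so [T] injects into
   [S]. *)
pose T := [fset p in P `*` P | D p.2 <= D p.1].
have TE p : p \in T = [&& p.1 \in P, p.2 \in P & D p.2 <= D p.1].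
  by rewrite !inE /= -andbA.
have cTS : (#|` T| <= #|` S|)%N.
  apply: (@leq_card_in_inj _ _ (fun p => g p.1 + D p.2)); last first.
    by move=> p; rewrite TE => /and3P[? ? _]; apply: inS.
  have sep x z x' z' : x \in P -> x' \in P -> z' \in P ->
      D z <= D x -> D x < D x' -> g x + D z < g x' + D z'.
    move=> xP x'P z'P zx xx'.
    have := gD_le _ _ xP x'P xx'; have := D_gt0 _ z'P; lra.
  move=> [x z] [x' z']; rewrite !TE /= => /and3P[xP zP zx] /and3P[x'P z'P zx'] e.
  have [lt|lt|/injD eqx] := ltgtP (D x) (D x').
  - by have := sep _ _ _ _ xP x'P z'P zx lt; rewrite e ltxx.
  - by have := sep _ _ _ _ x'P xP zP zx' lt; rewrite e ltxx.
  - move: e; rewrite (eqx xP x'P) => /addrI/injD -> //.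
(* The order by [D] is total, so [T] and its reflection cover the square; this costs the factor
   2. *)
have : (#|` P `*` P| <= #|` T `|` [fset (p.2, p.1) | p in T]|)%N.
  apply/fsubset_leq_card/fsubsetP => -[x z]; rewrite in_fsetM /= => /andP[xP zP].
  rewrite in_fsetU TE /= xP zP /=.
  case: leP => //= lt; apply/imfsetP; exists (z, x) => //=.
  by rewrite TE /= xP zP ltW.
rewrite card_fsetM => /leq_trans; rewrite -mulnn; apply.
rewrite mul2n -addnn; apply: leq_trans (leq_card_fsetU _ _).1 _.
by apply: leq_add => //; apply: leq_trans (leq_imfset_card _ _ _) _.
Qed.

Section Convex.
Variables (R : realType) (I : interval R) (f : R -> R).
Hypothesis fconv : strictly_convex_on I f.

(** Convexity with weight [(w - v) / (w - u)] at [u], denominators cleared so that later uses are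
    polynomial arithmetic. *)
Lemma convex_lt_chord u v w : u \in I -> w \in I -> u < v < w ->
  (w - u) * f v < (w - v) * f u + (v - u) * f w.
Proof.
move=> uI wI /andP[uv vw].
have uw : 0 < w - u by lra.
have t0 : 0 < (w - v) / (w - u) by apply: divr_gt0; lra.
have t1 : (w - v) / (w - u) < 1 by rewrite ltr_pdivrMr; lra.
have := fconv uI wI (negbT (lt_eqF (lt_trans uv vw))) t0 t1.
have -> : (w - v) / (w - u) * u + (1 - (w - v) / (w - u)) * w = v.
  by field; rewrite gt_eqF.
rewrite -(ltr_pM2l uw); congr (_ < _).
by field; rewrite gt_eqF.
Qed.

(** Both [u + d] and [v] lie strictly between [u] and [v + d], symmetrically about the midpoint.
    Adding their two chord bounds gives [f (u + d) + f v < f u + f (v + d)]. *)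
Lemma convex_increment_lt d u v : u \in I -> v + d \in I -> 0 < d -> u < v ->
  f (u + d) - f u < f (v + d) - f v.
Proof.
move=> uI vI d0 uv.
have := @convex_lt_chord u (u + d) (v + d) uI vI.
have := @convex_lt_chord u v (v + d) uI vI.
move=> /(_ ltac:(lra)) h1 /(_ ltac:(lra)) h2.
have w0 : 0 < v + d - u by lra.
rewrite -(ltr_pM2l w0); nra.
Qed.

(** Otherwise [f v] would exceed both end values, against the chord bound. The case [v = w] is kept
    because the least gap can be attained repeatedly. *)
Lemma convex_incr u v w : u \in I -> w \in I -> u < v <= w -> f u < f v ->
  f v <= f w.
Proof.
move=> uI wI /andP[uv]; rewrite le_eqVlt => /predU1P[->//|vw] fuv.
have := @convex_lt_chord u v w uI wI; rewrite uv vw => /(_ isT) h.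
rewrite leNgt; apply/negP => fwv; nra.
Qed.

Lemma convex_decr u v w : u \in I -> w \in I -> u <= v < w -> f w < f v ->
  f v <= f u.
Proof.
move=> uI wI /andP[]; rewrite le_eqVlt => /predU1P[->//|uv] vw fwv.
have := @convex_lt_chord u v w uI wI; rewrite uv vw => /(_ isT) h.
rewrite leNgt; apply/negP => fuv; nra.
Qed.

End Convex.

Lemma ex_min_gap (R : realDomainType) (A : {fset R}) : (1 < #|` A|)%N ->
  exists a a', [/\ a \in A, a' \in A, a < a' &
    {in A &, forall x y, x < y -> a' - a <= y - x}].
Proof.
move=> A1.
have [p0 p0lt] : exists p : A * A, val p.1 < val p.2.
  have A0 : A != fset0 by rewrite -cardfs_gt0 ltnW.
  have [x xA] := fset0Pn _ A0.
  have : A `\ x != fset0 by rewrite -cardfs_gt0; move: A1; rewrite (cardfsD1 x) xA.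
  move=> /fset0Pn[y]; rewrite !inE => /andP[nyx yA].
  have [yx|xy|e] := ltgtP y x; last by rewrite e eqxx in nyx.
    by exists ([` yA], [` xA]).
  by exists ([` xA], [` yA]).
have [[a a'] /= aa' amin] :=
  @Order.TotalTheory.arg_minP _ _ _ p0 (fun p : A * A => val p.1 < val p.2)
    (fun p => val p.2 - val p.1) p0lt.
exists (val a), (val a'); split => //; try exact: valP.
move=> x y xA yA xy.
exact: (amin ([` xA], [` yA])).
Qed.

Lemma mem_diffset_sumset (R : realType) (f : R -> R) (A : {fset R}) a a' x y z :
  x \in A -> y \in A -> z \in A ->
  f (a + x) + (f (a' + y) - f (a + z)) \in
    diffset (sumset (shift_image f a A) (shift_image f a' A)) (shift_image f a A).
Proof.
move=> xA yA zA; rewrite addrA; apply: in_imfset2; last exact: in_imfset.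
by apply: in_imfset2; exact: in_imfset.
Qed.

(** Transfers the bound from [- f] to [f], which reduces the concave case to the convex one. *)
Lemma diffset_sumset_opp (R : realType) (f : R -> R) (A : {fset R}) a a' :
  (#|` diffset (sumset (shift_image (fun x => - f x) a A)
                       (shift_image (fun x => - f x) a' A))
               (shift_image (fun x => - f x) a A)| <=
   #|` diffset (sumset (shift_image f a A) (shift_image f a' A))
               (shift_image f a A)|)%N.
Proof.
apply: (@leq_card_in_inj _ _ -%R) => [x y _ _|]; first exact: oppr_inj.
move=> _ /imfset2P[_ /imfset2P[_ /imfsetP[x xA ->] [_ /imfsetP[y yA ->] ->]]
  [_ /imfsetP[z zA ->] ->]].
have -> : - (- f (a + x) + - f (a' + y) - - f (a + z)) =
          f (a + x) + (f (a' + y) - f (a + z)) by ring.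
exact: mem_diffset_sumset.
Qed.

Lemma convex_growth (R : realType) (A : {fset R}) (I : interval R) (f : R -> R) :
  A != fset0 -> {subset sumset A A <= I} -> strictly_convex_on I f ->
  exists a a', [/\ a \in A, a' \in A &
    (#|` A| ^ 2 <= 18 * #|` diffset (sumset (shift_image f a A)
                                 (shift_image f a' A)) (shift_image f a A)|)%N].
Proof.
move=> A0 AI fconv.
(* A singleton has no positive gap; there it suffices that the set is nonempty. *)
have [A1|A1] := leqP #|` A| 1.
  have [x xA] := fset0Pn _ A0; exists x, x; split=> //.
  set S := diffset _ _.
  have : (0 < #|` S|)%N.
    by rewrite cardfs_gt0; apply/fset0Pn; eexists; exact: (mem_diffset_sumset f x x xA xA xA).
  nia.
have [a [a' [aA a'A aa' gap]]] := ex_min_gap A1.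
have memI x y : x \in A -> y \in A -> x + y \in I.
  by move=> xA yA; apply/AI/in_imfset2.
pose D x := f (a' + x) - f (a + x).
have Dlt x y : x \in A -> y \in A -> x < y -> D x < D y.
  move=> xA yA xy.
  have := @convex_increment_lt _ _ _ fconv (a' - a) (a + x) (a + y).
  have e t : a + t + (a' - a) = a' + t by ring.
  by rewrite !e; apply; rewrite ?memI ?subr_gt0 ?ltrD2l.
have Dinj : {in A &, injective D}.
  move=> x y xA yA e; have [lt|lt|//] := ltgtP x y.
    by have := Dlt _ _ xA yA lt; rewrite e ltxx.
  by have := Dlt _ _ yA xA lt; rewrite e ltxx.
have Dlt_inv x y : x \in A -> y \in A -> D x < D y -> x < y.
  move=> xA yA xy; rewrite ltNge le_eqVlt; apply/negP => /predU1P[e|lt].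
    by rewrite e ltxx in xy.
  by have := lt_trans (Dlt _ _ yA xA lt) xy; rewrite ltxx.
pose P := [fset x in A | 0 < D x].
pose N := [fset x in A | D x < 0].
pose Z := [fset x in A | D x == 0].
(* [D] is injective on [A], so it vanishes at most once. *)
have cZ : (#|` Z| <= 1)%N.
  rewrite -(cardfs1 (0 : R)); apply: (@leq_card_in_inj _ _ D).
    by move=> x y; rewrite !inE => /andP[xA _] /andP[yA _]; apply: Dinj.
  by move=> x; rewrite !inE => /andP[].
have cA : (#|` A| <= #|` P| + #|` N| + 1)%N.
  have : (#|` A| <= #|` P `|` N `|` Z|)%N.
    apply/fsubset_leq_card/fsubsetP => x xA; rewrite !inE xA /=.
    by case: ltgtP.
  have := (leq_card_fsetU (P `|` N) Z).1; have := (leq_card_fsetU P N).1.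
  lia.
pose S b b' := diffset (sumset (shift_image f b A) (shift_image f b' A))
                       (shift_image f b A).
have cP : (#|` P| ^ 2 <= 2 * #|` S a a'|)%N.
  apply: (@card_squeezed _ P _ (fun x => f (a + x)) D).
  - by move=> x y; rewrite !inE => /andP[xA _] /andP[yA _]; apply: Dinj.
  - by move=> x; rewrite !inE => /andP[].
  (* The left side is [f (a' + x)]. Minimality of the gap gives [a' + x <= a + y], and [f] has
     already risen from [a + x] to [a' + x]. *)
  - move=> x y; rewrite !inE => /andP[xA Dx] /andP[yA _] /(Dlt_inv _ _ xA yA) xy.
    rewrite /D addrC subrK.
    apply: (convex_incr fconv (u := a + x)); rewrite ?memI //.
      by have := gap _ _ xA yA xy; lra.
    by rewrite -subr_gt0.
  - move=> x z; rewrite !inE => /andP[xA _] /andP[zA _].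
    exact: mem_diffset_sumset.
have cN : (#|` N| ^ 2 <= 2 * #|` S a' a|)%N.
  apply: (@card_squeezed _ N _ (fun x => f (a' + x)) (fun x => f (a + x) - f (a' + x))).
  - move=> x y; rewrite !inE => /andP[xA _] /andP[yA _] e; apply: Dinj => //.
    by apply: oppr_inj; rewrite /D !opprB.
  - by move=> x; rewrite !inE /D => /andP[_]; lra.
  (* The weight is now [- D], which reverses the order: [y < x], hence [a' + y <= a + x < a' + x],
     and [f] falls on the last step. *)
  - move=> x y; rewrite !inE => /andP[xA Dx] /andP[yA _] lt.
    have {lt} yx : y < x by apply: Dlt_inv => //; rewrite /D; lra.
    rewrite addrC subrK.
    apply: (convex_decr fconv (w := a' + x)); rewrite ?memI //.
      by have := gap _ _ yA xA yx; lra.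
    by rewrite -subr_lt0.
  - move=> x z; rewrite !inE => /andP[xA _] /andP[zA _].
    exact: mem_diffset_sumset.
(* Let [m] be the larger of the two cardinalities. Then [#|] A| <= 2 m + 1[, and]m >=
   1[since]A[has at least two elements. So]#|[A| <= 3 m], and the square is at most [9 m ^ 2], hence
   at most 18 times the size of the set. *)
have [PN|NP] := leqP #|` N| #|` P|.
  by exists a, a'; split=> //; rewrite -/(S a a'); nia.
by exists a', a; split=> //; rewrite -/(S a' a); nia.
Qed.

Theorem theorem1p4 (R : realType) :
  exists c : R, 0 < c /\
    forall (A : {fset R}) (I : interval R) (f : R -> R),
      A != fset0 ->
      {subset sumset A A <= I} ->
      strictly_convex_on I f \/ strictly_concave_on I f ->
      exists a a' : R, [/\ a \in A, a' \in A &
        c * (#|` A| ^ 2)%:R <=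
          #|` diffset (sumset (shift_image f a A) (shift_image f a' A))
                      (shift_image f a A)|%:R].
Proof.
exists 18%:R^-1; split; first by rewrite invr_gt0 ltr0n.
move=> A I f A0 AI fI.
have [a [a' [aA a'A le]]] : exists a a', [/\ a \in A, a' \in A &
    (#|` A| ^ 2 <= 18 * #|` diffset (sumset (shift_image f a A)
                                 (shift_image f a' A)) (shift_image f a A)|)%N].
  case: fI => [fI|fI]; first exact: convex_growth fI.
  have fN : strictly_convex_on I (fun x => - f x).
    by move=> x y t xI yI xy t0 t1; have := fI x y t xI yI xy t0 t1; lra.
  have [a [a' [aA a'A le]]] := convex_growth A0 AI fN.
  exists a, a'; split=> //; apply: leq_trans le _.
  by rewrite leq_mul2l diffset_sumset_opp orbT.
by exists a, a'; split=> //; rewrite ler_pdivrMl ?ltr0n // -natrM ler_nat.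
Qed.
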